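(* Let $\psi=(\psi_1,\dots,\psi_m)$ be a permutation of $\{0,1,\dots,m-1\}$, and put $\pi_n=m-\psi_n$ for $n=1,\dots,m$. For each $n\in\{1,\dots,m\}$ let $O_0^{(n)},O_1^{(n)}$ be linear operators on polynomials in $z$, and let $\mathcal O_{ij}^{(n)}\in\{O_0^{(n)},O_1^{(n)}\}$ for $i,j\in\{1,2\}$. Define the configuration vector $\mathbf b_n^{\rm T}=[b_{11}^{(n)}\ b_{12}^{(n)}\ b_{21}^{(n)}\ b_{22}^{(n)}]\in\{0,1\}^4$ by $b_{ij}^{(n)}=0$ if $\mathcal O_{ij}^{(n)}=O_0^{(n)}$ and $b_{ij}^{(n)}=1$ if $\mathcal O_{ij}^{(n)}=O_1^{(n)}$. Let $R(z)$ be an arbitrary polynomial, $P^{(0)}(z)=Q^{(0)}(z)=R(z)$, and for $n=1,\dots,m$ $$P^{(n)}(z)=\mathcal O_{11}^{(n)}\{P^{(n-1)}(z)\}+\mathcal O_{12}^{(n)}\{Q^{(n-1)}(z)\}\,z^{2^{\psi_n}},$$ $$Q^{(n)}(z)=\mathcal O_{21}^{(n)}\{P^{(n-1)}(z)\}+\mathcal O_{22}^{(n)}\{Q^{(n-1)}(z)\}\,z^{2^{\psi_n}}.$$ Then $P^{(m)}$ and $Q^{(m)}$ can be obtained as $$P^{(m)}(z)=\sum_{i=0}^{2^m-1}O^{(m)}_{\check f_m(i)}\cdots O^{(2)}_{\check f_2(i)}O^{(1)}_{\check f_1(i)}\{R(z)\}\,z^i,$$ $$Q^{(m)}(z)=\sum_{i=0}^{2^m-1}O^{(m)}_{\check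 g_m(i)}\cdots O^{(2)}_{\check g_2(i)}O^{(1)}_{\check g_1(i)}\{R(z)\}\,z^i,$$ where the Boolean functions $f_n,g_n:\{0,1\}^m\to\{0,1\}$ of $\mathbf x=(x_1,\dots,x_m)$, which indicate which of the two operators $O_0^{(n)},O_1^{(n)}$ is involved in the coefficient of $z^i$, are given as follows. For $n=m$, $$f_m(\mathbf x)=b_{11}^{(m)}(1-x_{\pi_m})+b_{12}^{(m)}x_{\pi_m},\qquad g_m(\mathbf x)=b_{21}^{(m)}(1-x_{\pi_m})+b_{22}^{(m)}x_{\pi_m},$$ and for $1\le n<m$, $$f_n(\mathbf x)=g_n(\mathbf x)=b_{11}^{(n)}(1-x_{\pi_n})(1-x_{\pi_{n+1}})+b_{12}^{(n)}x_{\pi_n}(1-x_{\pi_{n+1}})+b_{21}^{(n)}(1-x_{\pi_n})x_{\pi_{n+1}}+b_{22}^{(n)}x_{\pi_n}x_{\pi_{n+1}}.$$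
   Context: Here $m$ is a positive integer. An operator $O$ transforms one polynomial in $z$ (with complex coefficients) to another polynomial; it is linear if $O\{aA(z)+bB(z)\}=aO\{A(z)\}+bO\{B(z)\}$ for all polynomials $A,B$ and all $a,b\in\mathbb C$. Juxtaposition of operators denotes composition. For a function $f$ of $\mathbf x\in\{0,1\}^m$, $\check f(i)$ denotes $f(\mathbf x)$ for the unique $\mathbf x$ with $i=\sum_{j=1}^m x_j2^{m-j}$ (so $x_1$ is the most significant bit).
   Formalization: Added assumption: each operator 𝒪_ij^(n) commutes with multiplication by z^{2^{ψ_l}} for every earlier stage l<n; linearity over ℂ alone does not suffice (e.g. m=2, stage-2 operators A(z)↦A(−z)). *)

(* Defs.v *)
From HB Require Import structures.
From mathcomp Require Import all_boot all_order all_fingroup all_algebra.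
From mathcomp Require Import complex.
From mathcomp Require Import reals.

Set Implicit Arguments.
Unset Strict Implicit.
Unset Printing Implicit Defensive.

Import Order.TTheory GRing.Theory Num.Theory.

Local Open Scope ring_scope.

(* Indices running over 1, ..., m in the mathematics are
   ordinals 0, ..., m-1 here: k : 'I_m stands for the index k + 1. *)

Notation cpoly R := {poly (complex R)}.

Notation polyop R := {linear cpoly R -> cpoly R}.

(* The delay z^k passes through O like a scalar. This does not follow from
   linearity over the complex numbers: O{A(z)} = A(-z) is linear, but sends
   A(z) z to - O{A(z)} z. *)
Definition commutes_with_delay (R : realType) (O : polyop R) (k : nat) : Prop :=
  forall A : cpoly R, O (A * 'X^k) = O A * 'X^k.

(* O^(m) ... O^(2) O^(1) {A}: foldl applies the operator of index 0 first. *)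
Definition compose_ops (R : realType) (m : nat) (O : 'I_m -> polyop R)
    (A : cpoly R) : cpoly R :=
  foldl (fun B n => O n B) A (enum 'I_m).

Notation bitvec m := {ffun 'I_m -> bool}.

Definition bitval (m : nat) (x : bitvec m) : nat :=
  (\sum_(j < m) x j * 2 ^ (m - j.+1))%N.

Definition bits (m i : nat) : bitvec m :=
  [ffun j : 'I_m => odd (i %/ 2 ^ (m - j.+1))].

Definition check (m : nat) (f : bitvec m -> bool) (i : nat) : bool :=
  f (bits m i).

(* pi_n = m - psi_n; as an ordinal it is shifted by one, m - psi_n - 1. *)
Definition perm_pi (m : nat) (psi : {perm 'I_m}) (n : 'I_m) : 'I_m :=
  rev_ord (psi n).

Lemma bitvalS (m : nat) (x : bitvec m.+1) :
  bitval x = (x ord0 * 2 ^ m + bitval [ffun j => x (lift ord0 j)])%N.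
Proof.
rewrite /bitval big_ord_recl subSS subn0; congr (_ + _)%N.
by apply: eq_bigr => j _; rewrite ffunE subSS.
Qed.

Lemma bitval_lt (m : nat) (x : bitvec m) : (bitval x < 2 ^ m)%N.
Proof.
elim: m x => [|m IH] x; first by rewrite /bitval big_ord0.
rewrite bitvalS expnS mul2n -addnn.
by case: (x ord0); rewrite ?mul1n ?mul0n ?ltn_add2l ?add0n ?ltn_addl.
Qed.

Lemma bitvalK (m : nat) (x : bitvec m) : bits m (bitval x) = x.
Proof.
elim: m x => [|m IH] x; first by apply/ffunP => -[].
apply/ffunP => j; rewrite ffunE bitvalS.
set y := [ffun j => _].
case: (unliftP ord0 j) => [k ->|->]; last first.
  rewrite subSS subn0 divnMDl ?expn_gt0 // divn_small ?bitval_lt //.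
  by rewrite addn0 oddb.
have -> : (m.+1 - (lift ord0 k).+1 = m - k.+1)%N by rewrite subSS.
have := congr1 (fun z : bitvec m => z k) (IH y).
rewrite !ffunE => <-.
have -> : (2 ^ m = 2 ^ k.+1 * 2 ^ (m - k.+1))%N by rewrite -expnD subnKC.
rewrite mulnA divnMDl ?expn_gt0 //.
by rewrite oddD oddM expnS oddM /= andbF.
Qed.

(* bits m i is the unique x with i = sum_j x_j 2^(m-j). *)
Lemma bitsP (m i : nat) (x : bitvec m) :
  (i < 2 ^ m)%N -> (i = bitval x <-> x = bits m i).
Proof.
move=> lt_i; split=> [->|->]; first by rewrite bitvalK.
have inj : injective (fun x : bitvec m => Ordinal (bitval_lt x)).
  by move=> y z /(congr1 val) /= E; rewrite -(bitvalK y) E bitvalK.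
have cE : #|bitvec m| = #|'I_(2 ^ m)| by rewrite card_ffun card_bool !card_ord.
have [g _ gK] := inj_card_bij inj (eq_leq (esym cE)).
have /(congr1 val) /= <- := gK (Ordinal lt_i).
by rewrite bitvalK.
Qed.

(* Main.v *)
Require Import Defs.
From HB Require Import structures.
From mathcomp Require Import all_boot all_order all_fingroup all_algebra.
From mathcomp Require Import complex.
From mathcomp Require Import reals.

Set Implicit Arguments.
Unset Strict Implicit.
Unset Printing Implicit Defensive.

Import Order.TTheory GRing.Theory Num.Theory.

Local Open Scope ring_scope.

(* Unrolling the recursion writes P^(m) and Q^(m) as a sum over paths: step n
   either keeps its P-input (y_n = 0) or its delayed Q-input (y_n = 1), and the
   operator of step n is the entry of the 2 x 2 array whose column is y_n and
   whose row is y_{n+1}, the component required by step n + 1 (or, at the last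
   step, the component P or Q being computed). The accumulated delay is
   sum_n y_n 2^{psi_n}, so that y_n is the bit x_{pi_n} of the exponent. *)

(** The delay accumulated along a path is a product of the monomials selected by its bits. An
    operator that passes each of them passes the product, one factor at a time. *)
Lemma commutes_with_delay_sum (R : realType) (O : polyop R) (n : nat)
    (y : 'I_n -> bool) (w : 'I_n -> nat) :
  (forall l, commutes_with_delay O (w l)) ->
  commutes_with_delay O (\sum_l y l * w l).
Proof.
move=> comm; elim/big_ind: _ => [A|k l commk comml A|l _ A].
- by rewrite expr0 !mulr1.
- by rewrite exprD !mulrA comml commk.
- by case: (y l); rewrite ?mul1n ?comm // mul0n expr0 !mulr1.
Qed.

Lemma eq_compose_ops (R : realType) (m : nat) (O O' : 'I_m -> polyop R)
    (A : cpoly R) :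
  (forall n, O n =1 O' n) -> compose_ops O A = compose_ops O' A.
Proof.
move=> eqO; rewrite /compose_ops; elim: (enum _) A => //= n s IH A.
by rewrite eqO.
Qed.

Lemma compose_opsSr (R : realType) (m : nat) (O : 'I_m.+1 -> polyop R)
    (A : cpoly R) :
  compose_ops O A =
  O ord_max (compose_ops (fun n => O (widen_ord (leqnSn m) n)) A).
Proof.
rewrite /compose_ops enum_ordSr foldl_rcons; congr (O _ _).
by elim: (enum _) A => //= n s IH A.
Qed.

Definition bits_rcons (m : nat) (y : bitvec m) (t : bool) : bitvec m.+1 :=
  [ffun i => oapp y t (unlift ord_max i)].

Lemma bits_rcons_max (m : nat) (y : bitvec m) (t : bool) :
  bits_rcons y t ord_max = t.
Proof. by rewrite ffunE unlift_none. Qed.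

Lemma bits_rcons_widen (m : nat) (y : bitvec m) (t : bool) (n : 'I_m) :
  bits_rcons y t (widen_ord (leqnSn m) n) = y n.
Proof.
rewrite ffunE (_ : widen_ord _ n = lift ord_max n) ?liftK //.
exact/val_inj/esym/lift_max.
Qed.

Lemma big_bits_rcons (V : nmodType) (m : nat) (F : bitvec m.+1 -> V) :
  \sum_y F y = \sum_(y : bitvec m) \sum_(t : bool) F (bits_rcons y t).
Proof.
rewrite pair_bigA /=.
rewrite (reindex (fun p : bitvec m * bool => bits_rcons p.1 p.2)) //=.
exists (fun y => ([ffun n => y (widen_ord (leqnSn m) n)], y ord_max)).
  move=> [y t] _ /=; rewrite bits_rcons_max; congr (_, _).
  by apply/ffunP => n; rewrite ffunE bits_rcons_widen.
move=> y _; apply/ffunP => n; rewrite ffunE /=.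
case: unliftP => [k ->|->] //=; rewrite ffunE; congr (y _).
exact/val_inj/esym/lift_max.
Qed.

(** This is the row index of step [n]. [insub] fails exactly at the last index, where the default
    [s], the component being computed, takes over. *)
Definition next_bit (m : nat) (s : bool) (y : bitvec m) (n : 'I_m) : bool :=
  oapp y s (insub n.+1).

Lemma next_bit_last (m : nat) (s : bool) (y : bitvec m) (n : 'I_m) :
  n.+1 = m -> next_bit s y n = s.
Proof. by move=> eqm; rewrite /next_bit insubF // eqm ltnn. Qed.

Lemma next_bit_init (m : nat) (s : bool) (y : bitvec m) (n n' : 'I_m) :
  n' = n.+1 :> nat -> next_bit s y n = y n'.
Proof. by move=> eqn; rewrite /next_bit -eqn valK. Qed.

(** The bit [t] used at the new last step decides which component the shorter path must produce, so
    it becomes the default there. *)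
Lemma next_bit_rcons (m : nat) (s t : bool) (y : bitvec m) (n : 'I_m) :
  next_bit s (bits_rcons y t) (widen_ord (leqnSn m) n) = next_bit t y n.
Proof.
have [lt_n|] := ltnP n.+1 m.
  rewrite (@next_bit_init _ t y n (Ordinal lt_n)) //.
  rewrite (@next_bit_init _ _ _ _ (widen_ord (leqnSn m) (Ordinal lt_n))) //.
  by rewrite bits_rcons_widen.
move=> le_m; have eqm : n.+1 = m by apply/eqP; rewrite eqn_leq ltn_ord.
rewrite (next_bit_last _ _ eqm) (@next_bit_init _ _ _ _ ord_max) //.
by rewrite bits_rcons_max.
Qed.

(** Induction on [m], peeling off the last step; both components [s] are treated together because
    the last step calls on both. The operators of step [n] only meet delays of steps [l < n], as the
    delay of step [n] is applied after them. *)
Lemma path_expansion (R : realType) (m : nat)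
    (T : 'I_m -> bool -> bool -> polyop R) (w : 'I_m -> nat) (A : cpoly R)
    (W : nat -> bool -> cpoly R) :
  (forall (n l : 'I_m) s t, (l < n)%N -> commutes_with_delay (T n s t) (w l)) ->
  (forall s, W 0%N s = A) ->
  (forall (n : 'I_m) s,
     W n.+1 s = T n s false (W n false) + T n s true (W n true) * 'X^(w n)) ->
  forall s, W m s = \sum_(y : bitvec m)
    compose_ops (fun n => T n (next_bit s y n) (y n)) A
      * 'X^(\sum_l y l * w l).
Proof.
elim: m T w => [|m IH] T w comm W0 WS s.
  rewrite W0 (big_pred1 [ffun=> false]) => [|y].
    by rewrite big_ord0 mulr1 /compose_ops enum_ord0.
  by symmetry; apply/eqP/ffunP => -[].
pose low := widen_ord (leqnSn m).
have {}IH := IH (T \o low) (w \o low) (fun n l s t => comm (low n) (low l) s t)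
  W0 (fun n => WS (low n)).
(* The factor [t] in the exponent covers both branches: the delay is trivial for [t = false] and
   [w ord_max] for [t = true]. *)
have step t : T ord_max s t (W m t) * 'X^(t * w ord_max) =
    \sum_(y : bitvec m)
      compose_ops
        (fun n => T n (next_bit s (bits_rcons y t) n) (bits_rcons y t n)) A
        * 'X^(\sum_l bits_rcons y t l * w l).
  rewrite IH linear_sum mulr_suml; apply: eq_bigr => y _.
  (* The last operator moves past the delay of all earlier steps and so acts on the coefficient
     alone. *)
  rewrite [T _ _ _ _]commutes_with_delay_sum => [|l];
    last exact: (comm ord_max (low l) s t (ltn_ord l)).
  rewrite -mulrA -exprD big_ord_recr /= bits_rcons_max.
  under [in RHS]eq_bigr => l _ do rewrite bits_rcons_widen.
  congr (_ * _); rewrite compose_opsSr bits_rcons_max next_bit_last //.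
  congr (T _ _ _ _); apply: eq_compose_ops => n B.
  by rewrite next_bit_rcons bits_rcons_widen.
rewrite (WS ord_max) big_bits_rcons exchange_big big_bool /= -!step.
by rewrite mul1n mul0n expr0 mulr1 addrC.
Qed.

(** Since pi_n = m - psi_n, the bit at pi_n has weight 2^{m - pi_n} = 2^{psi_n}; reindexing along pi
    gives the sum. *)
Lemma bitval_perm_pi (m : nat) (psi : {perm 'I_m}) (x : bitvec m) :
  (\sum_n x (perm_pi psi n) * 2 ^ psi n = bitval x)%N.
Proof.
have pi_inj : injective (perm_pi psi) by apply: inj_comp rev_ord_inj perm_inj.
rewrite /bitval [in RHS](reindex_inj pi_inj); apply: eq_bigr => n _.
by rewrite /perm_pi /= subnSK // subKn // ltnW.
Qed.

Lemma big_bits (V : nmodType) (m : nat) (F : bitvec m -> nat -> V) :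
  \sum_(i < 2 ^ m) F (bits m i) i = \sum_x F x (bitval x).
Proof.
rewrite (reindex (fun x : bitvec m => Ordinal (bitval_lt x))) /=.
  by apply: eq_bigr => x _; rewrite bitvalK.
exists (fun i : 'I_(2 ^ m) => bits m i) => [x _|i _]; first exact: bitvalK.
by apply: val_inj => /=; apply/esym/bitsP.
Qed.

Lemma big_perm_pi (V : nmodType) (m : nat) (psi : {perm 'I_m})
    (F : bitvec m -> V) :
  \sum_y F y = \sum_(x : bitvec m) F [ffun n => x (perm_pi psi n)].
Proof.
rewrite (reindex_inj (h := fun x : bitvec m => [ffun n => x (perm_pi psi n)])) //.
move=> x x' /ffunP eqx; apply/ffunP => j.
(* This index is the preimage of [j] under pi, which is [psi] followed by [rev_ord]. *)
have := eqx ((psi^-1)%g (rev_ord j)).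
by rewrite !ffunE /perm_pi permKV rev_ordK.
Qed.

Definition ord_of_bool (t : bool) : 'I_2 := if t then ord_max else ord0.

Lemma nat_of_bool_inj : injective nat_of_bool.
Proof. by case=> [] []. Qed.

Theorem lemma1 (R : realType) (m : nat) (m_gt0 : (0 < m)%N)
    (psi : {perm 'I_m})
    (O : 'I_m -> bool -> polyop R)
    (cO : 'I_m -> 'I_2 -> 'I_2 -> polyop R)
    (b : 'I_m -> 'I_2 -> 'I_2 -> bool)
    (hb : forall (n : 'I_m) (i j : 'I_2), cO n i j =1 O n (b n i j))
    (hdelay : forall (n l : 'I_m) (i j : 'I_2), (l < n)%N ->
       commutes_with_delay (cO n i j) (2 ^ psi l))
    (Rz : cpoly R)
    (P Q : nat -> cpoly R)
    (P0 : P 0%N = Rz) (Q0 : Q 0%N = Rz)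
    (PS : forall n : 'I_m, P n.+1 =
       cO n ord0 ord0 (P n) + cO n ord0 ord_max (Q n) * 'X^(2 ^ psi n))
    (QS : forall n : 'I_m, Q n.+1 =
       cO n ord_max ord0 (P n) + cO n ord_max ord_max (Q n) * 'X^(2 ^ psi n))
    (f g : 'I_m -> bitvec m -> bool)
    (f_last : forall (n : 'I_m) (x : bitvec m), n.+1 = m ->
       (f n x = b n ord0 ord0 * (1 - x (perm_pi psi n))
              + b n ord0 ord_max * x (perm_pi psi n) :> nat)%N)
    (g_last : forall (n : 'I_m) (x : bitvec m), n.+1 = m ->
       (g n x = b n ord_max ord0 * (1 - x (perm_pi psi n))
              + b n ord_max ord_max * x (perm_pi psi n) :> nat)%N)
    (f_init : forall (n n' : 'I_m) (x : bitvec m), n' = n.+1 :> nat ->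
       (f n x =
          b n ord0 ord0 * (1 - x (perm_pi psi n)) * (1 - x (perm_pi psi n'))
        + b n ord0 ord_max * x (perm_pi psi n) * (1 - x (perm_pi psi n'))
        + b n ord_max ord0 * (1 - x (perm_pi psi n)) * x (perm_pi psi n')
        + b n ord_max ord_max * x (perm_pi psi n) * x (perm_pi psi n') :> nat)%N)
    (g_init : forall (n : 'I_m) (x : bitvec m), (n.+1 < m)%N ->
       g n x = f n x) :
  P m = \sum_(i < 2 ^ m)
          compose_ops (fun n => O n (check (f n) i)) Rz * 'X^i
  /\
  Q m = \sum_(i < 2 ^ m)
          compose_ops (fun n => O n (check (g n) i)) Rz * 'X^i.
Proof.
(* One family holds both recursions: [false] stands for P and row or column 1, [true] for Q and row
   or column 2. *)
pose W n (s : bool) := if s then Q n else P n.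
pose T n s t := cO n (ord_of_bool s) (ord_of_bool t).
have W0 s : W 0%N s = Rz by case: s.
have WS (n : 'I_m) s :
    W n.+1 s = T n s false (W n false) + T n s true (W n true) * 'X^(2 ^ psi n).
  by case: s; [apply: QS | apply: PS].
(* Both claims reduce to a pointwise check that [h] picks the entry of [b] in row y_{n+1} and column
   y_n. *)
have expand s (h : 'I_m -> bitvec m -> bool) :
    (forall (x : bitvec m) n, let y := [ffun k => x (perm_pi psi k)] in
       h n x = b n (ord_of_bool (next_bit s y n)) (ord_of_bool (y n))) ->
    W m s = \sum_(i < 2 ^ m)
      compose_ops (fun n => O n (check (h n) i)) Rz * 'X^i.
  move=> hE.
  rewrite (@path_expansion _ _ T (fun n => 2 ^ psi n)%N _ W _ W0 WS); last first.
    by move=> n l s' t; apply: hdelay.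
  rewrite (big_bits (fun x i => compose_ops (fun n => O n (h n x)) Rz * 'X^i)).
  rewrite [in LHS](big_perm_pi psi); apply: eq_bigr => x _; congr (_ * 'X^_).
    by apply: eq_compose_ops => n A; rewrite hE /T hb.
  by rewrite -(bitval_perm_pi psi); apply: eq_bigr => n _; rewrite ffunE.
(* Before the last step the row is y_{n+1} for either value of [s], so one formula serves both [f]
   and [g]. *)
have init (n : 'I_m) (x : bitvec m) s : (n.+1 < m)%N ->
    let y := [ffun k => x (perm_pi psi k)] in
    f n x = b n (ord_of_bool (next_bit s y n)) (ord_of_bool (y n)).
  move=> lt_n y; rewrite (@next_bit_init _ s y n (Ordinal lt_n)) // !ffunE.
  apply: nat_of_bool_inj; rewrite (f_init n (Ordinal lt_n)) //.
  (* For each pair of bits exactly one of the four products of literals equals 1, and it selects the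
     matching entry of [b]. *)
  by case: (x _) (x _) => [] []; rewrite /= !(muln0, muln1, addn0, add0n).
have last_or_init (n : 'I_m) : n.+1 = m \/ (n.+1 < m)%N.
  by have := ltn_ord n; rewrite leq_eqVlt => /orP[/eqP|]; [left | right].
split; [apply: (expand false) | apply: (expand true)] => x n y;
  case: (last_or_init n) => [eqm|lt_n].
(* At the last step the row is fixed by the component, and only the column bit is left to
   examine. *)
- rewrite next_bit_last // ffunE; apply: nat_of_bool_inj; rewrite f_last //.
  by case: (x _); rewrite /= !(muln0, muln1, addn0, add0n).
- exact: init.
- rewrite next_bit_last // ffunE; apply: nat_of_bool_inj; rewrite g_last //.
  by case: (x _); rewrite /= !(muln0, muln1, addn0, add0n).
- by rewrite g_init //; apply: init.
Qed.
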